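(* Let $\mathcal H_v=(\mathbb C^2)^{\otimes n_v}$ and $\mathcal H_h=(\mathbb C^2)^{\otimes n_h}$ be the visible and hidden spaces, and let $H_1,\dots,H_N$ be operators on $\mathcal H_v\otimes\mathcal H_h$, each both Hermitian and unitary. For $\theta=(\theta_1,\dots,\theta_N)\in\mathbb R^N$ put $$\sigma=\sigma(\theta)=\prod_{j=1}^N e^{-iH_j\theta_j}\,|0\rangle\langle 0|\,\prod_{j=N}^1 e^{iH_j\theta_j},\qquad \sigma_v=\sigma_v(\theta)=\mathrm{Tr}_h[\sigma(\theta)],$$ and for $1\le k\le N$ put $\widetilde H_k=\prod_{j=1}^{k-1}e^{-iH_j\theta_j}\,H_k\,\prod_{j=k-1}^{1}e^{iH_j\theta_j}$. Let $\rho$ be a density operator on $\mathcal H_v$. (i) If $\sigma_v$ is invertible, the gradient of the maximal R\'enyi divergence of order two between $\rho$ and $\sigma_v$ is $$\partial_{\theta_k}\widetilde D_2(\rho\|\sigma_v(\theta))=\frac{i\,\mathrm{Tr}\left(\rho^2\sigma_v^{-1}\,\mathrm{Tr}_h([\widetilde H_k,\sigma])\,\sigma_v^{-1}\right)}{\mathrm{Tr}(\rho^2\sigma_v^{-1})}.$$ (ii) If $\rho$ is invertible, the gradient of the reverse divergence is $$\partial_{\theta_k}\widetilde D_2(\sigma_v\|\rho)=\frac{-i\,\mathrm{Tr}\left(\left\{\mathrm{Tr}_h([\widetilde H_k,\sigma]),\sigma_v\right\}\rho^{-1}\right)}{\mathrm{Tr}(\sigma_v^2\rho^{-1})}.$$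
   Context: A density operator is a positive semidefinite matrix of trace one. $|0\rangle$ is the all-zeros computational basis state of the $n_v+n_h$ qubits. Ordered products are written left to right: $\prod_{j=1}^N A_j=A_1A_2\cdots A_N$ and $\prod_{j=N}^1 A_j=A_NA_{N-1}\cdots A_1$. $\mathrm{Tr}_h$ is the partial trace over $\mathcal H_h$. $[A,B]=AB-BA$, $\{A,B\}=AB+BA$. The maximal R\'enyi divergence of order two is $\widetilde D_2(\rho\|\sigma)=\log\mathrm{Tr}(\rho^2\sigma^{-1})$ (natural logarithm), where the second argument is invertible. *)

(* Defs.v *)
From HB Require Import structures.
From mathcomp Require Import all_boot all_order all_algebra.
From mathcomp Require Import all_classical all_reals all_analysis.
From mathcomp.real_closed Require Import complex mxtens.

Set Implicit Arguments.
Unset Strict Implicit.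
Unset Printing Implicit Defensive.

Import Order.TTheory GRing.Theory Num.Theory.
Import numFieldNormedType.Exports.

Local Open Scope classical_set_scope.
Local Open Scope ring_scope.
Local Open Scope complex_scope.
Local Open Scope sesquilinear_scope.

(* The limit of the power series is taken in the norm topology of 'M[K]_n. *)
Definition expm (K : numFieldType) n (A : 'M[K]_n) : 'M[K]_n :=
  limn (series (fun k : nat => (k`!%:R)^-1 *: A ^+ k)).

Definition commutator (K : pzRingType) n (A B : 'M[K]_n) : 'M[K]_n :=
  A *m B - B *m A.

Definition anticommutator (K : pzRingType) n (A B : 'M[K]_n) : 'M[K]_n :=
  A *m B + B *m A.

(* On C^m (x) C^n, the index mxtens_index (a, c) labels the product basis
   vector e_a (x) e_c, as in the Kronecker product of mxtens. *)
Definition ptrace2 (K : pzRingType) m n (A : 'M[K]_(m * n)) : 'M[K]_m :=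
  \matrix_(a, b) \sum_(c < n) A (mxtens_index (a, c)) (mxtens_index (b, c)).

Definition psdmx (C : numClosedFieldType) n (A : 'M[C]_n) : Prop :=
  A \is hermsymmx /\ forall v : 'cV[C]_n, 0 <= (v ^t* *m A *m v) 0 0.

Definition densitymx (C : numClosedFieldType) n (A : 'M[C]_n) : Prop :=
  psdmx A /\ \tr A = 1.

(* Computational basis states are numbered by their bit strings, so the
   all-zeros state has index 0. *)
Definition ket0 (K : pzRingType) n : 'cV[K]_n := \col_(i < n) (i == 0%N :> nat)%:R.

(* The trace is a complex number, real for Hermitian arguments; the divergence
   is the real logarithm of its real part. The matrix invmx sigma is the inverse
   only where sigma is invertible. *)
Definition renyi2 (R : realType) n (rho sigma : 'M[R[i]]_n) : R :=
  ln (complex.Re (\tr (rho ^+ 2 *m invmx sigma))).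

Section Model.
Context (R : realType) (nv nh N : nat).
Variable H : 'I_N -> 'M[R[i]]_(2 ^ nv * 2 ^ nh).
Implicit Types theta : 'rV[R]_N.

(* Both index_enum 'I_N (used by \prod_(j < N)) and enum 'I_N are increasing, so
   the noncommutative products below are in increasing, resp. decreasing order. *)
Definition gate theta (j : 'I_N) := expm (- ('i * (theta 0 j)%:C) *: H j).
Definition gate_inv theta (j : 'I_N) := expm (('i * (theta 0 j)%:C) *: H j).

Definition model theta : 'M[R[i]]_(2 ^ nv * 2 ^ nh) :=
  (\prod_(j < N) gate theta j)
  *m (ket0 _ _ *m (ket0 _ _) ^t*)
  *m (\prod_(j <- rev (enum 'I_N)) gate_inv theta j).

Definition model_visible theta : 'M[R[i]]_(2 ^ nv) := ptrace2 (model theta).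

Definition Htilde theta (k : 'I_N) : 'M[R[i]]_(2 ^ nv * 2 ^ nh) :=
  (\prod_(j < N | (j < k)%N) gate theta j)
  *m H k
  *m (\prod_(j <- rev (enum 'I_N) | (j < k)%N) gate_inv theta j).

End Model.

(* Main.v *)
Require Import Defs.
From HB Require Import structures.
From mathcomp Require Import all_boot all_order all_algebra.
From mathcomp Require Import all_classical all_reals all_analysis.
From mathcomp Require Import ring.
From mathcomp.real_closed Require Import complex mxtens.

(* Since H_j^2 = 1, each gate is cos(theta_j) - i sin(theta_j) H_j. Hence moving
   theta_k by h conjugates the state by cos(h) - i sin(h) Ht_k, and
     sigma_v(theta + h e_k) = cos(h)^2 sigma_v - i sin(h) cos(h) Tr_h [Ht_k, sigma]
                              + sin(h)^2 Tr_h (Ht_k sigma Ht_k),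
   so that the derivative of sigma_v is - i Tr_h [Ht_k, sigma]. The gradients follow
   from the product rule and d(A^-1) = - A^-1 (dA) A^-1. The logarithm can be
   differentiated because Tr (A^2 B^-1) > 0 whenever A is Hermitian and nonzero and
   B is positive semidefinite and invertible. *)

Set Implicit Arguments.
Unset Strict Implicit.
Unset Printing Implicit Defensive.

Import Order.TTheory GRing.Theory Num.Theory.
Import numFieldNormedType.Exports.

Local Open Scope classical_set_scope.
Local Open Scope ring_scope.
Local Open Scope complex_scope.
Local Open Scope sesquilinear_scope.

(** * Adjoints, positive semidefinite forms and positivity of the trace *)

Section Adjoint.
Context (C : numClosedFieldType).

Lemma trmxC_mul m n p (A : 'M[C]_(m, n)) (B : 'M[C]_(n, p)) :
  (A *m B)^t* = B^t* *m A^t*.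
Proof. by rewrite trmx_mul map_mxM. Qed.

Lemma trmxCD m n (A B : 'M[C]_(m, n)) : (A + B)^t* = A^t* + B^t*.
Proof. by rewrite linearD map_mxD. Qed.

Lemma trmxCB m n (A B : 'M[C]_(m, n)) : (A - B)^t* = A^t* - B^t*.
Proof. by rewrite linearB map_mxB. Qed.

Lemma trmxCZ m n a (A : 'M[C]_(m, n)) : (a *: A)^t* = (a^*)%R *: A^t*.
Proof. by rewrite linearZ map_mxZ. Qed.

Lemma trmxC1 n : (1%:M : 'M[C]_n)^t* = 1%:M.
Proof. by rewrite trmx1 map_mx1. Qed.

Lemma trmxC_inv n (A : 'M[C]_n) : (invmx A)^t* = invmx (A^t*).
Proof. by rewrite trmx_inv map_invmx. Qed.

Lemma mxtrace_trmxC n (A : 'M[C]_n) : \tr (A^t*) = ((\tr A)^*)%R.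
Proof.
rewrite -map_trmx mxtrace_tr /mxtrace rmorph_sum.
by apply: eq_bigr => i _; rewrite mxE. Qed.

Lemma hermsymmxP n (A : 'M[C]_n) : reflect (A^t* = A) (A \is hermsymmx).
Proof.
by apply: (iffP (is_hermitianmxP _ _ _)); rewrite expr0 scale1r => /esym.
Qed.

Lemma trmxC_prod n (I : Type) (s : seq I) (F : I -> 'M[C]_n) :
  (\prod_(j <- s) F j)^t* = \prod_(j <- rev s) (F j)^t*.
Proof.
elim: s => [|j s IH]; first by rewrite !big_nil [LHS]trmxC1.
rewrite big_cons rev_cons -cats1 big_cat big_seq1 -IH.
exact: trmxC_mul.
Qed.

Lemma dot_colE n (v : 'cV[C]_n) : (v^t* *m v) 0 0 = \sum_i `|v i 0| ^+ 2.
Proof. by rewrite mxE; apply: eq_bigr => i _; rewrite !mxE mulrC -normCK. Qed.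

Lemma dot_col_ge0 n (v : 'cV[C]_n) : 0 <= (v^t* *m v) 0 0.
Proof. by rewrite dot_colE sumr_ge0 // => i _; rewrite exprn_ge0. Qed.

Lemma dot_col_eq0 n (v : 'cV[C]_n) : (v^t* *m v) 0 0 = 0 -> v = 0.
Proof.
rewrite dot_colE => /psumr_eq0P v0.
apply/colP => i; rewrite mxE; apply/eqP; rewrite -normr_eq0 -sqrf_eq0.
by apply/eqP/v0 => // j _; rewrite exprn_ge0.
Qed.

Lemma psdmx_gram m n (M : 'M[C]_(m, n)) : psdmx (M *m M^t*).
Proof.
split=> [|v]; first by apply/hermsymmxP; rewrite trmxC_mul trmxCK.
suff -> : v^t* *m (M *m M^t*) *m v = (M^t* *m v)^t* *m (M^t* *m v).
  exact: dot_col_ge0.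
by rewrite trmxC_mul trmxCK !mulmxA.
Qed.

(* Along w - t B w, t > 0, the form is - 2 t |B w|^2 + O(t^2): it would become
   negative if B w were nonzero. *)
Lemma psdmx_ker n (B : 'M[C]_n) (w : 'cV[C]_n) :
  psdmx B -> (w^t* *m B *m w) 0 0 = 0 -> B *m w = 0.
Proof.
case=> /hermsymmxP hB pB w0; apply: dot_col_eq0.
set v := B *m w; set a := (v^t* *m v) 0 0.
have a_ge0 : 0 <= a by exact: dot_col_ge0.
pose b := (v^t* *m B *m v) 0 0; have b_ge0 : 0 <= b by exact: pB.
have b1 : 0 < b + 1 by rewrite ltr_wpDl.
apply/eqP; move: a_ge0; rewrite le_eqVlt => /orP[/eqP <- //|a_gt0].
(* The summand 1 keeps the denominator positive even when [b] is 0. With this [t], t b <= a, whereas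
   positivity of the form forces 2 a <= t b. *)
pose t := a / (b + 1); have t_gt0 : 0 < t by rewrite divr_gt0.
have tC : (t^*)%R = t by rewrite conj_Creal // ger0_real // ltW.
have q : ((w - t *: v)^t* *m B *m (w - t *: v)) 0 0 = t * (t * b - a *+ 2).
  have vE : v^t* = w^t* *m B by rewrite trmxC_mul hB.
  have -> : (w - t *: v)^t* *m B *m (w - t *: v) =
     w^t* *m B *m w - t *: (v^t* *m v) - t *: (v^t* *m v)
     + t *: (t *: (v^t* *m B *m v)).
    rewrite trmxCB trmxCZ tC mulmxBr !mulmxBl -!scalemxAl -!scalemxAr -vE.
    by rewrite -(mulmxA _ B w) -/v opprB addrA addrAC -addrA addrCA addrA.
  have coordE (P Q S : 'M[C]_1) : P 0 0 = 0 ->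
      (P - t *: Q - t *: Q + t *: (t *: S)) 0 0 = t * (t * S 0 0 - Q 0 0 *+ 2).
    by rewrite !mxE => ->; ring.
  exact: coordE.
have := pB (w - t *: v); rewrite q pmulr_rge0 // subr_ge0 => le_a.
have : a *+ 2 <= a.
  apply: (le_trans le_a); rewrite /t -mulrA -[leRHS]mulr1 ler_pM2l //.
  by rewrite mulrC ler_pdivrMr // mul1r lerDl.
by rewrite mulr2n gerDl => /(lt_le_trans a_gt0); rewrite ltxx.
Qed.

Lemma sandwich_diagE m n (B : 'M[C]_n) (W : 'M[C]_(n, m)) i :
  (W^t* *m B *m W) i i = ((col i W)^t* *m B *m col i W) 0 0.
Proof.
rewrite tr_col map_row -row_mul [LHS]mxE [RHS]mxE.
by apply: eq_bigr => j _; rewrite !mxE. Qed.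

Lemma psdmx_sandwich_ge0 m n (B : 'M[C]_n) (W : 'M[C]_(n, m)) :
  psdmx B -> 0 <= \tr (W^t* *m B *m W).
Proof.
case=> _ pB; rewrite /mxtrace sumr_ge0 // => i _.
by rewrite sandwich_diagE pB.
Qed.

(** The diagonal entries are nonnegative, so each vanishes; by [psdmx_ker] every column of [W] then
    lies in the kernel of [B]. *)
Lemma psdmx_sandwich_eq0 m n (B : 'M[C]_n) (W : 'M[C]_(n, m)) :
  psdmx B -> \tr (W^t* *m B *m W) = 0 -> B *m W = 0.
Proof.
move=> psdB /psumr_eq0P W0; apply/matrixP => j i.
have /psdmx_ker : (((col i W)^t*) *m B *m col i W) 0 0 = 0.
  by rewrite -sandwich_diagE W0 // => l _; rewrite sandwich_diagE; case: psdB.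
move=> /(_ psdB)/colP/(_ j); rewrite !mxE.
by apply: etrans; apply: eq_bigr => l _; rewrite mxE.
Qed.

(** With W = B^-1 A, cyclicity turns the trace into that of W^* B W. It is nonnegative, and if it
    were zero then B W = A would vanish. *)
Lemma mxtrace_sqr_invmx_gt0 n (A B : 'M[C]_n) :
  A \is hermsymmx -> A != 0 -> psdmx B -> B \in unitmx ->
  0 < \tr (A ^+ 2 *m invmx B).
Proof.
move=> /hermsymmxP hA A_neq0 psdB B_unit.
have hB : B^t* = B by case: psdB => /hermsymmxP.
pose W := invmx B *m A.
have -> : \tr (A ^+ 2 *m invmx B) = \tr (W^t* *m B *m W).
  rewrite trmxC_mul trmxC_inv hA hB mulmxKV // mulmxA [RHS]mxtrace_mulC mulmxA.
  by rewrite expr2.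
rewrite lt_def psdmx_sandwich_ge0 // andbT; apply: contra_neq A_neq0.
by move/psdmx_sandwich_eq0 => /(_ psdB); rewrite mulKVmx.
Qed.
End Adjoint.

(** * Linearity and positivity of the partial trace *)

Section PartialTrace.
Context (C : numClosedFieldType) (m n : nat).
Implicit Types A B : 'M[C]_(m * n).

Lemma ptrace2D A B : ptrace2 (A + B) = ptrace2 A + ptrace2 B.
Proof.
apply/matrixP => i j; rewrite !mxE -big_split.
by apply: eq_bigr => c _; rewrite !mxE.
Qed.

Lemma ptrace2Z a A : ptrace2 (a *: A) = a *: ptrace2 A.
Proof.
apply/matrixP => i j; rewrite !mxE mulr_sumr.
by apply: eq_bigr => c _; rewrite !mxE.
Qed.

Lemma ptrace2_trmxC A : ptrace2 (A^t*) = (ptrace2 A)^t*.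
Proof.
apply/matrixP => i j; rewrite !mxE rmorph_sum.
by apply: eq_bigr => c _; rewrite !mxE.
Qed.

Lemma mxtrace_ptrace2 A : \tr (ptrace2 A) = \tr A.
Proof.
rewrite /mxtrace (reindex (@mxtens_index m n)) /=; last first.
  by exists (@mxtens_unindex m n) => x _; rewrite ?mxtens_indexK ?mxtens_unindexK.
transitivity (\sum_i \sum_c A (mxtens_index (i, c)) (mxtens_index (i, c))).
  by apply: eq_bigr => i _; rewrite mxE.
by rewrite pair_bigA; apply: eq_bigr => -[].
Qed.

(** Reshaping the vector [u] into a matrix [M], with visible indices for rows and hidden indices for
    columns, turns the partial trace into a Gram matrix. *)
Lemma psdmx_ptrace2_gram (u : 'cV[C]_(m * n)) : psdmx (ptrace2 (u *m u^t*)).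
Proof.
pose M := \matrix_(a < m, c < n) u (mxtens_index (a, c)) 0.
suff -> : ptrace2 (u *m u^t*) = M *m M^t* by exact: psdmx_gram.
apply/matrixP => i j; rewrite !mxE; apply: eq_bigr => c _.
by rewrite !mxE big_ord1 !mxE.
Qed.
End PartialTrace.

(** * Exponentials of involutions as rotations *)

Section Rotation.
Context (R : realType) (n : nat).
Local Notation C := (R[i] : numFieldType).
Implicit Types (A : 'M[C]_n) (x y : R).

(** Closed form of exp(- i x A) when A^2 = 1, as [expm_involution] shows. *)
Definition rotmx A x : 'M[C]_n := (cos x)%:C%:M - ('i * (sin x)%:C) *: A.

(** A^2 = 1 makes the product of the two sine terms scalar, so the addition formulas for cosine and
    sine apply. *)
Lemma rotmxD A x y : A *m A = 1%:M -> rotmx A (x + y) = rotmx A x *m rotmx A y.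
Proof.
move=> A2; rewrite /rotmx mulmxBl !mulmxBr !mul_scalar_mx -!scalemxAl.
rewrite !mul_mx_scalar -!scalemxAr A2.
have -> : (cos (x + y))%:C = (cos x)%:C * (cos y)%:C
    + 'i ^+ 2 * ((sin x)%:C * (sin y)%:C) :> C.
  by rewrite cosD sqrCi mulN1r rmorphB !rmorphM.
have -> : (sin (x + y))%:C = (sin x)%:C * (cos y)%:C
    + (cos x)%:C * (sin y)%:C :> C.
  by rewrite sinD rmorphD !rmorphM.
apply/matrixP => p q; rewrite !mxE.
by case: (p == q); rewrite ?mulr1n ?mulr0n; ring.
Qed.

Lemma rotmx0 A : rotmx A 0 = 1%:M.
Proof. by rewrite /rotmx cos0 sin0 mulr0 scale0r subr0. Qed.

Lemma conj_real_complex x : ((x%:C : R[i])^*)%R = x%:C.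
Proof. by rewrite conj_Creal //; apply/complex_realP; exists x. Qed.

Lemma rotmx_trmxC A x : A^t* = A -> (rotmx A x)^t* = rotmx A (- x).
Proof.
move=> hA; rewrite /rotmx cosN sinN trmxCB trmxCZ hA.
rewrite tr_scalar_mx map_scalar_mx rmorphM /= conjCi !conj_real_complex.
by rewrite rmorphN mulrN mulNr.
Qed.

Lemma cvg_real_complex (T : Type) (F : set_system T) (FF : Filter F)
    (f : T -> R) (a : R) :
  f x @[x --> F] --> a -> ((f x)%:C : C) @[x --> F] --> (a%:C : C).
Proof.
move=> /cvgrPdist_lt fa; apply/cvgrPdist_lt => /= e e_gt0.
(* The radius [e] lies in [R[i]]; being positive it is real, so its real part serves as a radius in
   [R]. *)
have /RRe_real eE : e \is Num.real by rewrite gtr0_real.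
have /fa : 0 < complex.Re e by rewrite -ltcR eE.
apply: filterS => x; rewrite -ltcR eE; apply: le_lt_trans.
by rewrite -rmorphB normc_def /= expr0n addr0 sqrtr_sqr.
Qed.

Lemma cvg_Re (T : Type) (F : set_system T) (FF : Filter F)
    (f : T -> C) (a : C) :
  f x @[x --> F] --> a -> complex.Re (f x) @[x --> F] --> complex.Re a.
Proof.
move=> /cvgrPdist_lt fa; apply/cvgrPdist_lt => /= e e0.
have /fa : 0 < e%:C :> C by rewrite ltcR.
apply: filterS => x; rewrite -ltcR; apply: le_lt_trans.
by rewrite -raddfB normc_ge_Re.
Qed.

Lemma involution_expr A k : A *m A = 1%:M -> A ^+ k = if odd k then A else 1%:M.
Proof.
move=> A2; elim: k => [|k IH]; first by rewrite expr0.
rewrite exprS IH /=; case: (odd k) => /=; [exact: A2|exact: mulmx1].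
Qed.

Lemma scalemx_expr (c : C) A k : (c *: A) ^+ k = c ^+ k *: A ^+ k.
Proof.
elim: k => [|k IH]; first by rewrite !expr0 scale1r.
rewrite !exprS IH [LHS](_ : _ = c *: A *m (c ^+ k *: A ^+ k)) //.
by rewrite -scalemxAl -scalemxAr scalerA.
Qed.

(** Even powers of [A] are 1 and odd ones are [A], so each partial sum of the exponential splits
    into partial sums of the cosine and sine series. *)
Lemma expm_involution A x : A *m A = 1%:M ->
  expm (- ('i * x%:C) *: A) = rotmx A x.
Proof.
move=> A2; apply: cvg_lim; first exact: norm_hausdorff.
have -> : series (fun k => (k`!%:R)^-1 *: (- ('i * x%:C) *: A) ^+ k) =
   (fun k => ((series (cos_coeff x) k)%:C : C) *: (1%:M : 'M[C]_n)
      + (('i : C)* (series (sin_coeff x) k)%:C) *: - A).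
  apply/funext => n'; rewrite /series /= !rmorph_sum /= mulr_sumr !scaler_suml.
  rewrite -big_split.
  apply: eq_bigr => k _ /=; rewrite scalemx_expr (involution_expr k A2) scalerA.
  have sqr_c : (- ('i * x%:C) : C) ^+ 2 = -1 * x%:C ^+ 2.
    by rewrite sqrrN exprMn sqrCi.
  (* Write [k] as its parity plus twice its half; the even part only involves the square of the
     scalar, which is - x^2. *)
  have exprE : (- ('i * x%:C) : C) ^+ k =
     (- 'i) ^+ odd k * (-1) ^+ k./2 * x%:C ^+ k.
    have kE := odd_double_half k; rewrite -mul2n in kE.
    rewrite -[in LHS]kE exprD exprM sqr_c -mulNr.
    rewrite (exprMn _ (-1)) (exprMn _ (-'i)) -exprM.
    by rewrite -[in X in _ = _ * X]kE exprD; ring.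
  (* [sin_coeff] takes its sign from [k.-1./2], while [exprE] has [k./2]; they agree on odd [k], the
     only terms that survive there. *)
  have halfE : odd k -> k.-1./2 = k./2.
    by case: (k) => //= l /negbTE ok; rewrite uphalf_half ok.
  rewrite exprE /cos_coeff /sin_coeff /= -exprnP !rmorphM !fmorphV !rmorph_nat.
  rewrite !rmorphXn !rmorphN1; case: (odd k) halfE => /= halfE.
    rewrite (halfE isT) !mul0r scale0r add0r scalerN -scaleNr; congr (_ *: _).
    by ring.
  by rewrite !mul0r mulr0 scale0r addr0; congr (_ *: _); ring.
have cvg_cos : (series (cos_coeff x) k)%:C @[k --> \oo] --> ((cos x)%:C : C).
  apply: cvg_real_complex; rewrite unlock; exact: is_cvg_series_cos_coeff.
have cvg_sin : (series (sin_coeff x) k)%:C @[k --> \oo] --> ((sin x)%:C : C).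
  apply: cvg_real_complex; rewrite unlock; exact: is_cvg_series_sin_coeff.
rewrite /rotmx -[(cos x)%:C%:M]scalemx1 -scalerN.
have cvg_cosZ : ((series (cos_coeff x) k)%:C : C) *: (1%:M : 'M[C]_n) @[k --> \oo]
    --> ((cos x)%:C : C) *: (1%:M : 'M[C]_n).
  exact: cvgZr_tmp cvg_cos.
have cvg_sinZ : (('i : C) * (series (sin_coeff x) k)%:C) *: - A @[k --> \oo]
    --> (('i : C) * (sin x)%:C) *: - A.
  exact: cvgZr_tmp (cvgMl_tmp cvg_sin).
exact: cvgD cvg_cosZ cvg_sinZ.
Qed.
End Rotation.

(** * Entrywise limits and continuity of matrix operations *)

Section MatrixLimits.
Context {K : numFieldType} {T : Type} {F : set_system T} {FF : Filter F}.

(** A neighbourhood of [A] contains a box of entrywise neighbourhoods, and the finitely many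
    conditions on entries hold jointly along the filter. *)
Lemma cvg_coordP m n (f : T -> 'M[K]_(m, n)) (A : 'M[K]_(m, n)) :
  f x @[x --> F] --> A <-> forall i j, f x i j @[x --> F] --> A i j.
Proof.
split=> [fA i j|fA].
  exact: (@cvg_comp _ _ _ f (fun M : 'M[K]_(m, n) => M i j) _ _ _ fA
    (@coord_continuous K m n i j A)).
move=> V /= [P PA sPV].
have : \forall x \near F, forall i j, P i j (f x i j).
  by apply: filter_forall => i; apply: filter_forall => j; exact: fA (PA i j).
by apply: filterS => x; exact: sPV.
Qed.

Lemma cvg_sumr (I : Type) (s : seq I) (f : I -> T -> K) (a : I -> K) :
  (forall i, f i x @[x --> F] --> a i) ->
  \sum_(i <- s) f i x @[x --> F] --> \sum_(i <- s) a i.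
Proof. by move=> fa; apply: cvg_big => //; exact: add_continuous. Qed.

Lemma cvg_mulmx m n p (f : T -> 'M[K]_(m, n)) (g : T -> 'M[K]_(n, p))
    (A : 'M[K]_(m, n)) (B : 'M[K]_(n, p)) :
  f x @[x --> F] --> A -> g x @[x --> F] --> B ->
  f x *m g x @[x --> F] --> A *m B.
Proof.
move=> /cvg_coordP fA /cvg_coordP gB; apply/cvg_coordP => i j.
under eq_fun do rewrite mxE.
by rewrite mxE; apply: cvg_sumr => l; apply: cvgM.
Qed.

Lemma cvg_mxtrace n (f : T -> 'M[K]_n) (A : 'M[K]_n) :
  f x @[x --> F] --> A -> \tr (f x) @[x --> F] --> \tr A.
Proof. by move=> /cvg_coordP fA; apply: cvg_sumr => i. Qed.

Lemma cvg_det n (f : T -> 'M[K]_n) (A : 'M[K]_n) :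
  f x @[x --> F] --> A -> \det (f x) @[x --> F] --> \det A.
Proof.
move=> /cvg_coordP fA; apply: cvg_sumr => s; apply: cvgMl_tmp.
by apply: cvg_big => //; exact: mul_continuous.
Qed.

Lemma cvg_adjugate n (f : T -> 'M[K]_n) (A : 'M[K]_n) :
  f x @[x --> F] --> A -> \adj (f x) @[x --> F] --> \adj A.
Proof.
move=> /cvg_coordP fA; apply/cvg_coordP => i j.
under eq_fun do rewrite mxE.
rewrite mxE; apply: cvgMl_tmp; apply: cvg_det; apply/cvg_coordP => p q.
under eq_fun do rewrite !mxE.
rewrite !mxE; exact: fA.
Qed.

Lemma near_unitmx n (f : T -> 'M[K]_n) (A : 'M[K]_n) :
  f x @[x --> F] --> A -> A \in unitmx -> \forall x \near F, f x \in unitmx.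
Proof.
move=> /cvg_det fA; rewrite unitmxE unitfE => detA.
near=> x; rewrite unitmxE unitfE; near: x.
exact: cvgr_neq0 detA.
Unshelve. all: by end_near.
Qed.

(** The adjugate over the determinant is continuous where the determinant is nonzero. Since [invmx]
    returns a singular matrix unchanged, this formula is used only eventually along [F], where [f x]
    is invertible. *)
Lemma cvg_invmx n (f : T -> 'M[K]_n) (A : 'M[K]_n) :
  f x @[x --> F] --> A -> A \in unitmx ->
  invmx (f x) @[x --> F] --> invmx A.
Proof.
move=> fA A_unit.
have /near_eq_cvg : \forall x \near F, (\det (f x))^-1 *: \adj (f x) = invmx (f x).
  by apply: filterS (near_unitmx fA A_unit) => x fx; rewrite /invmx fx.
move=> eqV; apply: (cvg_trans eqV); rewrite /invmx A_unit.
have detV : (\det (f x))^-1 @[x --> F] --> (\det A)^-1.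
  by apply: cvgV; [rewrite -unitfE -unitmxE|exact: cvg_det].
exact: (cvgZ detV (cvg_adjugate fA)).
Qed.
End MatrixLimits.

(** * Derivatives along a line, and of traces of inverses and squares *)

Section DirectionalDerivative.
Context {R : realType}.
Local Notation C := (R[i] : numFieldType).

Lemma is_derive_line (V W : normedModType R) (f : V -> W) (g : R -> W) a v dg :
  (forall h, g h = f (h *: v + a)) -> is_derive (0 : R) 1 g dg ->
  is_derive a v f dg.
Proof.
move=> gE [dfg <-]; rewrite /derivable /derive in dfg *.
suff E : (fun h : R => h^-1 *: ((f \o shift a) (h *: v) - f a)) =
         (fun h => h^-1 *: ((g \o shift 0) (h *: 1) - g 0)).
  by split; rewrite /derivable /derive E.
by apply/funext => h; rewrite /= !gE scale0r add0r addr0 [h *: 1]mulr1.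
Qed.

(** Multiplying by the real number h^-1 commutes with taking real parts, so the real part of [f] is
    differentiable. Positivity of [f 0] in the complex order makes its real part positive, and the
    chain rule for the logarithm applies. *)
Lemma is_derive_ln_Re (f : R -> C) (L : C) :
  (h^-1)%:C * (f h - f 0) @[h --> 0^'] --> L -> 0 < f 0 ->
  is_derive (0 : R) 1 (fun h => ln (complex.Re (f h)))
    (complex.Re L / complex.Re (f 0)).
Proof.
move=> /cvg_Re fL f0_gt0.
have Re_gt0 : 0 < complex.Re (f 0) by move: f0_gt0; rewrite ltcE => /andP[].
have dRe : is_derive (0 : R) 1 (fun h => complex.Re (f h)) (complex.Re L).
  have cvgL : h^-1 *: (((fun h => complex.Re (f h)) \o shift 0) (h *: 1)
      - complex.Re (f 0)) @[h --> (0 : R)^'] --> complex.Re L.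
    apply: cvg_trans fL; apply: near_eq_cvg; near=> h => /=.
    rewrite addr0 [h *: 1]mulr1 -raddfB.
    by case: (f h - f 0) => x y /=; rewrite mul0r subr0.
  by split; [apply/cvg_ex; exists (complex.Re L)|exact: cvg_lim cvgL].
rewrite mulrC; apply: is_derive1_comp.
exact: is_derive1_ln.
Unshelve. all: by end_near. Qed.

Context {n : nat} (S : R -> 'M[C]_n) (dS : 'M[C]_n).
Hypothesis dSE : ((h^-1)%:C : C) *: (S h - S 0) @[h --> 0^'] --> dS.

Lemma diff_quotientK h : h != 0 ->
  S h = S 0 + (h%:C : C) *: (((h^-1)%:C : C) *: (S h - S 0)).
Proof.
by move=> h0; rewrite scalerA -rmorphM mulfV // scale1r addrC subrK.
Qed.

(** Differentiability implies continuity: away from h = 0, [S h] is [S 0] plus [h] times the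
    difference quotient. *)
Lemma cvg_diff_quotient : S h @[h --> 0^'] --> S 0.
Proof.
have cvg0 : (h%:C : C) @[h --> (0 : R)^'] --> ((0 : R)%:C : C).
  by apply: cvg_real_complex; apply: nbhs_dnbhs.
have : S 0 + (h%:C : C) *: (((h^-1)%:C : C) *: (S h - S 0)) @[h --> 0^']
    --> S 0 + ((0 : R)%:C : C) *: dS.
  exact: cvgD (cvg_cst _) (cvgZ cvg0 dSE).
rewrite scale0r addr0; apply: cvg_trans; apply: near_eq_cvg.
by near=> h; rewrite -diff_quotientK //; near: h; exact: nbhs_dnbhs_neq.
Unshelve. all: by end_near. Qed.

(** Rests on the resolvent identity S_h^-1 - S_0^-1 = - S_h^-1 (S_h - S_0) S_0^-1, valid for small
    [h], and on continuity of the inverse. *)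
Lemma cvg_diff_mxtrace_invmx (A : 'M[C]_n) : S 0 \in unitmx ->
  ((h^-1)%:C : C) * (\tr (A *m invmx (S h)) - \tr (A *m invmx (S 0))) @[h --> 0^']
  --> - \tr (A *m invmx (S 0) *m dS *m invmx (S 0)).
Proof.
move=> S0.
have cvgV : invmx (S h) @[h --> 0^'] --> invmx (S 0).
  exact: cvg_invmx cvg_diff_quotient S0.
have : - \tr (A *m invmx (S h) *m (((h^-1)%:C : C) *: (S h - S 0))
    *m invmx (S 0)) @[h --> 0^']
    --> - \tr (A *m invmx (S 0) *m dS *m invmx (S 0)).
  apply: cvgN; apply: cvg_mxtrace; apply: cvg_mulmx; last exact: cvg_cst.
  exact: cvg_mulmx (cvg_mulmx (cvg_cst A) cvgV) dSE.
apply: cvg_trans; apply: near_eq_cvg; near=> h.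
have Sh : S h \in unitmx by near: h; exact: near_unitmx cvg_diff_quotient S0.
rewrite -scalemxAr -scalemxAl mxtraceZ -mulrN; congr (_ * _).
by rewrite mulmxBr mulmxBl mulmxKV // mulmxK // raddfB /= opprB.
Unshelve. all: by end_near. Qed.

(** S_h^2 - S_0^2 = (S_h - S_0) S_h + S_0 (S_h - S_0); as the factors need not commute, the limit is
    an anticommutator. *)
Lemma cvg_diff_mxtrace_sqr (A : 'M[C]_n) :
  ((h^-1)%:C : C) * (\tr (S h ^+ 2 *m A) - \tr (S 0 ^+ 2 *m A)) @[h --> 0^']
  --> \tr (anticommutator dS (S 0) *m A).
Proof.
have cvgS := cvg_diff_quotient.
have : \tr (((((h^-1)%:C : C) *: (S h - S 0)) *m S h
    + S 0 *m (((h^-1)%:C : C) *: (S h - S 0))) *m A) @[h --> 0^']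
    --> \tr (anticommutator dS (S 0) *m A).
  apply: cvg_mxtrace; apply: cvg_mulmx; last exact: cvg_cst.
  exact: cvgD (cvg_mulmx dSE cvgS) (cvg_mulmx (cvg_cst _) dSE).
apply: cvg_trans; apply: near_eq_cvg; near=> h.
rewrite -scalemxAl -scalemxAr -scalerDr -scalemxAl mxtraceZ -raddfB /= -mulmxBl.
by rewrite (mulmxBl (S h) (S 0) (S h)) mulmxBr addrA subrK !expr2.
Unshelve. all: by end_near. Qed.
End DirectionalDerivative.

(** * Ordered products split at one index *)

Lemma enum_ord_splitP N (k : 'I_N) : exists s1 s2,
  [/\ enum 'I_N = s1 ++ k :: s2, all (fun j : 'I_N => j < k)%N s1
    & all (fun j : 'I_N => k < j)%N s2].
Proof.
have sorted_enum : sorted (fun i j : 'I_N => i < j)%N (enum 'I_N).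
  by have := iota_ltn_sorted 0 N; rewrite -val_enum_ord sorted_map.
have /splitPr E : k \in enum 'I_N by rewrite mem_enum.
case: E sorted_enum => s1 s2; rewrite sorted_pairwise; last first.
  by move=> j i l; exact: ltn_trans.
rewrite pairwise_cat /= => /and3P[s1k _ /andP[ks2 _]].
exists s1, s2; split=> //.
by move: s1k; rewrite allrel_consr => /andP[].
Qed.

Lemma filter_ltn_cat (N : nat) (k : 'I_N) (s1 s2 : seq 'I_N) :
  all (fun j : 'I_N => j < k)%N s1 -> all (fun j : 'I_N => k < j)%N s2 ->
  [seq j : 'I_N <- s1 ++ k :: s2 | (j < k)%N] = s1.
Proof.
move=> /all_filterP s1k s2k; rewrite filter_cat /= ltnn s1k.
rewrite (_ : [seq j : 'I_N <- s2 | (j < k)%N] = [::]) ?cats0 //.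
rewrite (eq_in_filter (a2 := pred0)) ?filter_pred0 // => j /(allP s2k) /=.
by move=> kj; apply/negbTE; rewrite -leqNgt ltnW.
Qed.

Lemma prod_mx_split (K : pzRingType) d (I : Type) (s1 s2 : seq I) k
    (F : I -> 'M[K]_d) :
  \prod_(j <- s1 ++ k :: s2) F j =
  (\prod_(j <- s1) F j) *m F k *m \prod_(j <- s2) F j.
Proof.
elim: s1 => [|j s1 IH] /=; rewrite !big_cons; first by rewrite big_nil mul1mx.
by rewrite IH -!mulmxE !mulmxA.
Qed.

(** A factor [E] inserted at position [k] moves to the front as U E V, because V U = 1 gives U E V U
    = U E. *)
Lemma prod_mx_update (K : pzRingType) d (I : eqType) (s1 s2 : seq I) k
    (F G : I -> 'M[K]_d) (E V : 'M[K]_d) :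
  let U := \prod_(j <- s1) F j in
  V *m U = 1%:M -> G k = E *m F k -> (forall j, j != k -> G j = F j) ->
  k \notin s1 -> k \notin s2 ->
  \prod_(j <- s1 ++ k :: s2) G j =
  U *m E *m V *m \prod_(j <- s1 ++ k :: s2) F j.
Proof.
move=> U VU Gk GF ks1 ks2.
have G_eq s : k \notin s -> \prod_(j <- s) G j = \prod_(j <- s) F j.
  move=> ks; apply: eq_big_seq => j js; apply: GF.
  by apply: contraNneq ks => <-.
rewrite !prod_mx_split (G_eq s1) // (G_eq s2) // Gk !mulmxA -/U.
by rewrite -(mulmxA (U *m E) V U) VU mulmx1.
Qed.

(** * The circuit state and its dependence on one angle *)

Section Circuit.
Context (R : realType) (nv nh N : nat).
Variable H : 'I_N -> 'M[R[i]]_(2 ^ nv * 2 ^ nh).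
Hypothesis H_herm : forall j, H j \is hermsymmx.
Hypothesis H_unitary : forall j, H j \is unitarymx.
Implicit Types (theta : 'rV[R]_N) (k : 'I_N).

Lemma H_trmxC j : (H j)^t* = H j.
Proof. exact/hermsymmxP. Qed.

Lemma H_involution j : H j *m H j = 1%:M.
Proof. by rewrite -[X in _ *m X]H_trmxC; apply/unitarymxP. Qed.

Lemma gate_rotmx theta j : gate H theta j = rotmx (H j) (theta 0 j).
Proof. exact/expm_involution/H_involution. Qed.

Lemma gate_inv_trmxC theta j : gate_inv H theta j = (gate H theta j)^t*.
Proof.
rewrite gate_rotmx (rotmx_trmxC _ (H_trmxC j)).
rewrite -(expm_involution _ (H_involution j)).
by rewrite /gate_inv rmorphN mulrN opprK.
Qed.

Lemma gate_unitary theta j : (gate H theta j)^t* *m gate H theta j = 1%:M.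
Proof.
rewrite gate_rotmx (rotmx_trmxC _ (H_trmxC j)).
by rewrite -(rotmxD _ _ (H_involution j)) addNr rotmx0.
Qed.

Lemma prod_gate_unitary theta (s : seq 'I_N) :
  (\prod_(j <- s) gate H theta j)^t* *m (\prod_(j <- s) gate H theta j) = 1%:M.
Proof.
elim: s => [|j s IH]; first by rewrite big_nil [X in X *m _]trmxC1 mulmx1.
rewrite big_cons trmxC_mul mulmxA -(mulmxA _ _ (gate _ _ _)) gate_unitary mulmx1.
exact: IH.
Qed.

Lemma prod_gate_inv_trmxC theta (s : seq 'I_N) :
  \prod_(j <- rev s) gate_inv H theta j = (\prod_(j <- s) gate H theta j)^t*.
Proof.
by rewrite trmxC_prod; apply: eq_bigr => j _; rewrite gate_inv_trmxC.
Qed.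

Lemma prod_ordE (F : 'I_N -> 'M[R[i]]_(2 ^ nv * 2 ^ nh)) (P : pred 'I_N) :
  \prod_(j < N | P j) F j = \prod_(j <- [seq j <- enum 'I_N | P j]) F j.
Proof. by rewrite big_filter [index_enum _]unlock enumT. Qed.

(** The decreasing product of inverse gates is the adjoint of the increasing product of gates, so
    the state is pure; its hermiticity and the positivity of the visible state follow. *)
Lemma model_gram theta :
  let u := (\prod_(j <- enum 'I_N) gate H theta j) *m ket0 _ _ in
  model H theta = u *m u^t*.
Proof.
rewrite /model prod_gate_inv_trmxC prod_ordE filter_predT /=.
by rewrite trmxC_mul !mulmxA.
Qed.

Lemma Htilde_conj theta k s1 s2 :
  enum 'I_N = s1 ++ k :: s2 -> all (fun j : 'I_N => j < k)%N s1 ->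
  all (fun j : 'I_N => k < j)%N s2 ->
  let U := \prod_(j <- s1) gate H theta j in
  Htilde H theta k = U *m H k *m U^t*.
Proof.
move=> enumE s1k s2k U.
rewrite /Htilde -[X in _ *m X]big_filter filter_rev prod_gate_inv_trmxC.
by rewrite prod_ordE enumE filter_ltn_cat.
Qed.

Lemma Htilde_trmxC theta k : (Htilde H theta k)^t* = Htilde H theta k.
Proof.
have [s1 [s2 [enumE s1k s2k]]] := enum_ord_splitP k.
by rewrite (Htilde_conj theta enumE) // !trmxC_mul trmxCK H_trmxC mulmxA.
Qed.

Lemma gate_line theta k h j :
  gate H (h *: delta_mx 0 k + theta) j =
  if j == k then rotmx (H k) h *m gate H theta k else gate H theta j.
Proof.
rewrite !gate_rotmx !mxE eqxx /=; case: eqP => [->|_].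
  by rewrite mulr1 rotmxD // H_involution.
by rewrite mulr0 add0r.
Qed.

(** Shifting the angle of gate [k] by [h] inserts the rotation of [H k] at that gate; carried to the
    front through the preceding gates, it becomes the rotation of [Htilde]. *)
Lemma model_line theta k h :
  model H (h *: delta_mx 0 k + theta) =
  rotmx (Htilde H theta k) h *m model H theta *m rotmx (Htilde H theta k) (- h).
Proof.
have [s1 [s2 [enumE s1k s2k]]] := enum_ord_splitP k.
pose U := \prod_(j <- s1) gate H theta j.
(* The scalar part needs U U^* = 1, which [mulmx1C] draws from U^* U = 1. *)
have rotE : rotmx (Htilde H theta k) h = U *m rotmx (H k) h *m U^t*.
  rewrite (Htilde_conj theta enumE) // /rotmx mulmxBr mulmxBl.
  rewrite mul_mx_scalar -!scalemxAl -!scalemxAr -scalemxAl.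
  by rewrite (mulmx1C (prod_gate_unitary theta s1)) scalemx1.
have prodE : \prod_(j <- enum 'I_N) gate H (h *: delta_mx 0 k + theta) j =
    rotmx (Htilde H theta k) h *m \prod_(j <- enum 'I_N) gate H theta j.
  rewrite enumE rotE; apply: prod_mx_update.
  - exact: prod_gate_unitary.
  - by rewrite gate_line eqxx.
  - by move=> j jk; rewrite gate_line ifN.
  - by apply/negP => /(allP s1k); rewrite ltnn.
  - by apply/negP => /(allP s2k); rewrite ltnn.
have := model_gram (h *: delta_mx 0 k + theta); rewrite prodE => ->.
rewrite (model_gram theta) -(rotmx_trmxC _ (Htilde_trmxC theta k)).
by rewrite !trmxC_mul !mulmxA.
Qed.

Lemma mxtrace_model theta : \tr (model H theta) = 1.
Proof.
rewrite model_gram mxtrace_mulC trmxC_mul mulmxA -(mulmxA _ _ (\prod_(j <- _) _)).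
rewrite prod_gate_unitary mulmx1 /mxtrace big_ord1 dot_colE.
(* The dimension is positive, so index 0 exists; it carries the only nonzero entry of [ket0]. *)
have dim_gt0 : (0 < 2 ^ nv * 2 ^ nh)%N by rewrite muln_gt0 !expn_gt0.
rewrite (bigD1 (Ordinal dim_gt0)) //= big1 => [|i i0].
  by rewrite mxE /= normr1 expr1n addr0.
by rewrite mxE (negbTE (_ : i != 0%N :> nat)) // normr0 expr0n.
Qed.

Lemma psdmx_model_visible theta : psdmx (model_visible H theta).
Proof. by rewrite /model_visible model_gram; exact: psdmx_ptrace2_gram. Qed.
End Circuit.

(** * Conjugation by a rotation and its derivative at angle 0 *)

Section RotationLimit.
Context {R : realType} {n : nat}.
Local Notation C := (R[i] : numFieldType).

Lemma mulmx_sandwichE (K : comPzRingType) d (A B : 'M[K]_d) a b :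
  (a%:M - b *: A) *m B *m (a%:M + b *: A) =
  a ^+ 2 *: B - (b * a) *: commutator A B - b ^+ 2 *: (A *m B *m A).
Proof.
rewrite mulmxBl mul_scalar_mx -scalemxAl mulmxDr mul_mx_scalar -scalemxAr.
rewrite mulmxBl -!scalemxAl /commutator.
move: (A *m B) (B *m A) (A *m B *m A) => X Y Z.
by apply/matrixP => p q; rewrite !mxE; ring.
Qed.

Lemma rotmx_conj (A B : 'M[R[i]]_n) h :
  rotmx A h *m B *m rotmx A (- h) =
  (cos h ^+ 2)%:C *: B - ('i * (sin h * cos h)%:C) *: commutator A B
  + (sin h ^+ 2)%:C *: (A *m B *m A).
Proof.
rewrite /rotmx cosN sinN rmorphN mulrN scaleNr opprK mulmx_sandwichE.
rewrite exprMn sqrCi mulN1r scaleNr opprK -mulrA -rmorphM -!rmorphXn.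
by [].
Qed.

Lemma cvg_sinc : h^-1 * sin h @[h --> (0 : R)^'] --> (1 : R).
Proof.
have [dsin] := is_derive_sin (0 : R); rewrite cos0 /derive => <-.
apply: cvg_trans dsin; apply: near_eq_cvg; near=> h => /=.
by rewrite addr0 sin0 subr0 [h *: 1]mulr1.
Unshelve. all: by end_near. Qed.

(** As cos^2 = 1 - sin^2, the quotient is exactly (sin^2 h / h) (X - P) - i (sin h cos h / h) Q. The
    first coefficient tends to 0, and sin h cos h / h tends to 1. *)
Lemma cvg_diff_rotation (P Q X : 'M[C]_n) :
  let S h := ((cos h ^+ 2)%:C : C) *: P - (('i : C) * (sin h * cos h)%:C) *: Q
    + ((sin h ^+ 2)%:C : C) *: X in
  ((h^-1)%:C : C) *: (S h - S 0) @[h --> (0 : R)^'] --> - ('i : C) *: Q.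
Proof.
move=> S.
have cvg_sin : sin h @[h --> (0 : R)^'] --> (0 : R).
  by rewrite -[X in _ --> X]sin0; apply/continuous_withinNx/continuous_sin.
have cvg_cos : cos h @[h --> (0 : R)^'] --> (1 : R).
  by rewrite -[X in _ --> X]cos0; apply/continuous_withinNx/continuous_cos.
have cvgc : ((h^-1 * sin h * cos h)%:C : C) @[h --> (0 : R)^'] --> ((1 * 1)%:C : C).
  by apply: cvg_real_complex; exact: cvgM cvg_sinc cvg_cos.
have cvgs : ((h^-1 * sin h * sin h)%:C : C) @[h --> (0 : R)^'] --> ((1 * 0)%:C : C).
  by apply: cvg_real_complex; exact: cvgM cvg_sinc cvg_sin.
have : ((h^-1 * sin h * sin h)%:C : C) *: (X - P)
   - (('i : C) * (h^-1 * sin h * cos h)%:C) *: Q @[h --> (0 : R)^'] -->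
   ((1 * 0)%:C : C) *: (X - P) - (('i : C) * (1 * 1)%:C) *: Q.
  exact: cvgB (cvgZr_tmp cvgs) (cvgZr_tmp (cvgMl_tmp cvgc)).
rewrite mulr0 scale0r sub0r !mulr1 -scaleNr; apply: cvg_trans.
apply: near_eq_cvg; near=> h; rewrite /S.
have cos2 : cos h ^+ 2 = 1 - sin h ^+ 2 by rewrite -(cos2Dsin2 h) addrK.
rewrite sin0 cos0 cos2 expr1n expr0n mul0r mulr0 !scale0r subr0 addr0 scale1r.
rewrite rmorphB !rmorphM rmorph1.
by apply/matrixP => p q; rewrite !mxE; ring.
Unshelve. all: by end_near. Qed.
End RotationLimit.

(** * The derivative of the visible state and its symmetry *)

Lemma commutator_trmxC (K : numClosedFieldType) d (A B : 'M[K]_d) :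
  A^t* = A -> B^t* = B -> (commutator A B)^t* = - commutator A B.
Proof. by move=> hA hB; rewrite /commutator trmxCB !trmxC_mul hA hB opprB. Qed.

Section VisibleGradient.
Context (R : realType) (nv nh N : nat).
Variable H : 'I_N -> 'M[R[i]]_(2 ^ nv * 2 ^ nh).
Hypothesis H_herm : forall j, H j \is hermsymmx.
Hypothesis H_unitary : forall j, H j \is unitarymx.
Variables (theta : 'rV[R]_N) (k : 'I_N).
Local Notation C := (R[i] : numFieldType).
Local Notation dTr := (ptrace2 (commutator (Htilde H theta k) (model H theta))).

Lemma cvg_diff_model_visible (S : R -> 'M[R[i]]_(2 ^ nv)) :
  (forall h, S h = model_visible H (h *: delta_mx 0 k + theta)) ->
  ((h^-1)%:C : C) *: (S h - S 0) @[h --> (0 : R)^'] --> - ('i : C) *: dTr.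
Proof.
move=> SE.
pose X := ptrace2 (Htilde H theta k *m model H theta *m Htilde H theta k).
have -> : S = fun h => ((cos h ^+ 2)%:C : C) *: model_visible H theta
    - (('i : C) * (sin h * cos h)%:C) *: dTr + ((sin h ^+ 2)%:C : C) *: X.
  apply/funext => h; rewrite SE /model_visible (model_line H_herm H_unitary).
  by rewrite rotmx_conj -scaleNr 2!ptrace2D 3!ptrace2Z scaleNr.
exact: cvg_diff_rotation.
Qed.

(** The commutator of two Hermitian matrices is anti-Hermitian, and the partial trace commutes with
    the adjoint. *)
Lemma dTr_trmxC : dTr^t* = - dTr.
Proof.
rewrite -ptrace2_trmxC -scaleN1r -ptrace2Z scaleN1r; congr ptrace2.
have model_trmxC : (model H theta)^t* = model H theta.
  by rewrite (model_gram H_herm H_unitary) trmxC_mul trmxCK.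
by apply: commutator_trmxC => //; exact: Htilde_trmxC.
Qed.
End VisibleGradient.

(** Since [L] is self-conjugate and [f 0] is positive, both are real: dropping imaginary parts loses
    nothing, and the real derivative embeds as the complex quotient. *)
Lemma is_derive_line_ln_Re (R : realType) (V : normedModType R) (D : V -> R)
    (f : R -> R[i]) a v (L : R[i]) :
  (forall h, D (h *: v + a) = ln (complex.Re (f h))) ->
  ((h^-1)%:C * (f h - f 0) : (R[i] : numFieldType)) @[h --> (0 : R)^']
    --> (L : (R[i] : numFieldType)) ->
  0 < f 0 -> (L^*)%R = L ->
  derivable D a v /\ ('D_v D a)%:C = L / f 0.
Proof.
move=> DE fL f0_gt0 L_real.
have dD : is_derive a v D (complex.Re L / complex.Re (f 0)).
  apply: is_derive_line (is_derive_ln_Re fL f0_gt0).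
  by move=> h; rewrite DE.
split; first exact: ex_derive.
have L_Re : (complex.Re L)%:C = L by rewrite RRe_real // CrealE L_real.
have f0_Re : (complex.Re (f 0))%:C = f 0 by rewrite RRe_real // gtr0_real.
by rewrite derive_val rmorphM fmorphV /= L_Re f0_Re.
Qed.

(** * Reality of the derivatives of the traces *)

Section RealGradient.
Context (K : numClosedFieldType) (n : nat).
Implicit Types A B X : 'M[K]_n.

(** The adjoint reverses the Hermitian factors, and cyclicity of the trace restores their order. *)
Lemma conj_mxtrace_sandwich A B X :
  A^t* = A -> B^t* = B -> X^t* = X ->
  ((\tr (A ^+ 2 *m invmx B *m X *m invmx B))^*)%R =
  \tr (A ^+ 2 *m invmx B *m X *m invmx B).
Proof.
move=> hA hB hX; rewrite -mxtrace_trmxC expr2 -mulmxE !trmxC_mul trmxC_inv.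
rewrite hA hB hX; move: (A *m A) => A2.
by rewrite -!mulmxA [RHS]mxtrace_mulC -!mulmxA.
Qed.

Lemma conj_mxtrace_anticommutator A B X :
  A^t* = A -> B^t* = B -> X^t* = X ->
  ((\tr (anticommutator X B *m invmx A))^*)%R =
  \tr (anticommutator X B *m invmx A).
Proof.
move=> hA hB hX; rewrite -mxtrace_trmxC trmxC_mul trmxCD !trmxC_mul trmxC_inv.
by rewrite hA hB hX addrC mxtrace_mulC.
Qed.
End RealGradient.

Theorem theorem2p1 (R : realType) (nv nh N : nat)
    (H : 'I_N -> 'M[R[i]]_(2 ^ nv * 2 ^ nh))
    (H_herm : forall j, H j \is hermsymmx)
    (H_unitary : forall j, H j \is unitarymx)
    (rho : 'M[R[i]]_(2 ^ nv)) (rho_density : densitymx rho)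
    (theta : 'rV[R]_N) (k : 'I_N) :
  let sigma := model H theta in
  let sigma_v := model_visible H theta in
  let dTr := ptrace2 (commutator (Htilde H theta k) sigma) in
  let e_k : 'rV[R]_N := delta_mx 0 k in
  (sigma_v \in unitmx ->
     let D := fun t : 'rV[R]_N => renyi2 rho (model_visible H t) in
     derivable D theta e_k /\
     ('D_e_k D theta)%:C =
       'i * \tr (rho ^+ 2 *m invmx sigma_v *m dTr *m invmx sigma_v)
       / \tr (rho ^+ 2 *m invmx sigma_v))
  /\
  (rho \in unitmx ->
     let D := fun t : 'rV[R]_N => renyi2 (model_visible H t) rho in
     derivable D theta e_k /\
     ('D_e_k D theta)%:C =
       - 'i * \tr (anticommutator dTr sigma_v *m invmx rho)
       / \tr (sigma_v ^+ 2 *m invmx rho)).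
Proof.
move=> sigma sigma_v dTr e_k.
have [rho_psd rho_tr] := rho_density.
have rho_herm : rho \is hermsymmx by case: rho_psd.
have sigma_psd : psdmx sigma_v by exact: psdmx_model_visible.
have sigma_herm : sigma_v \is hermsymmx by case: sigma_psd.
(* Trace one excludes the zero matrix, as strict positivity of the argument of the logarithm
   requires. *)
have neq0 (A : 'M[R[i]]_(2 ^ nv)) : \tr A = 1 -> A != 0.
  by apply: contra_eq_neq => ->; rewrite mxtrace0 eq_sym oner_eq0.
have sigma_tr : \tr sigma_v = 1.
  by rewrite mxtrace_ptrace2; exact: mxtrace_model.
have rhoC : rho^t* = rho by exact/hermsymmxP.
have sigmaC : sigma_v^t* = sigma_v by exact/hermsymmxP.
have dTrC : dTr^t* = - dTr by exact: dTr_trmxC.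
(* The factor - i turns the anti-Hermitian [dTr] into a Hermitian derivative of the visible state,
   which makes both numerators real. *)
have dC : (- 'i *: dTr)^t* = - 'i *: dTr.
  by rewrite trmxCZ dTrC rmorphN /= conjCi opprK scalerN scaleNr.
(* Obtaining [S] from an existential keeps it opaque: only [SE] relates it to the circuit. *)
have [S SE] : exists S, forall h : R, S h = model_visible H (h *: e_k + theta).
  exists (fun h => model_visible H (h *: e_k + theta)) => h; reflexivity.
have S0 : S 0 = sigma_v by rewrite SE scale0r add0r.
have dS := cvg_diff_model_visible H_herm H_unitary SE.
split=> [sigma_unit|rho_unit] D.
  have S_unit : S 0 \in unitmx by rewrite S0.
  have dtr := cvg_diff_mxtrace_invmx dS (A := rho ^+ 2) S_unit.
  (* The minus sign from differentiating the inverse cancels the one in - i, which explains the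
     opposite signs of the two gradients. *)
  have dE : - \tr (rho ^+ 2 *m invmx (S 0) *m (- 'i *: dTr) *m invmx (S 0))
      = 'i * \tr (rho ^+ 2 *m invmx sigma_v *m dTr *m invmx sigma_v).
    by rewrite S0 -scalemxAr -scalemxAl mxtraceZ mulNr opprK.
  rewrite -dE -[in X in _ / X]S0.
  apply: (is_derive_line_ln_Re (f := fun h => \tr (rho ^+ 2 *m invmx (S h))) _ dtr).
  - by move=> h; rewrite /D /renyi2 SE.
  - by rewrite S0; apply: mxtrace_sqr_invmx_gt0 => //; exact: neq0.
  - by rewrite rmorphN /= conj_mxtrace_sandwich // S0.
have dtr := cvg_diff_mxtrace_sqr dS (A := invmx rho).
have dE : \tr (anticommutator (- 'i *: dTr) (S 0) *m invmx rho)
    = - 'i * \tr (anticommutator dTr sigma_v *m invmx rho).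
  by rewrite S0 /anticommutator -scalemxAl -scalemxAr -scalerDr -scalemxAl mxtraceZ.
rewrite -dE -[in X in _ / X]S0.
apply: (is_derive_line_ln_Re (f := fun h => \tr (S h ^+ 2 *m invmx rho)) _ dtr).
- by move=> h; rewrite /D /renyi2 SE.
- by rewrite S0; apply: mxtrace_sqr_invmx_gt0 => //; exact: neq0.
- by rewrite conj_mxtrace_anticommutator // S0.
Qed.
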